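(* Let $\Omega\subset\mathbb{R}^N$ be a bounded domain, $1\le j\le N$, $\epsilon>0$, and let $g:\mathbb{R}^N\setminus\Omega\to\mathbb{R}$ be continuous. Let $u^\epsilon_I$ and $u^\epsilon_{II}$ be the values for Player I and Player II of the game described in the context. Then the game has a value $u^\epsilon=u^\epsilon_I=u^\epsilon_{II}$, and it verifies $$u^\epsilon(x)=\inf_{\dim(S)=j}\ \sup_{v\in S,\,|v|=1}\left\{\tfrac12u^\epsilon(x+\epsilon v)+\tfrac12u^\epsilon(x-\epsilon v)\right\},\qquad x\in\Omega,$$ $$u^\epsilon(x)=g(x),\qquad x\notin\Omega,$$ where the infimum is over linear subspaces $S\subset\mathbb{R}^N$ of dimension $j$.
   Context: The game (two-player, zero-sum). A token starts at $x_0\in\Omega$. At each round, with the token at $x_k\in\Omega$, Player I (who minimizes the expected payoff) chooses a linear subspace $S\subset\mathbb{R}^N$ of dimension $j$; then Player II (who maximizes) chooses a unit vector $v\in S$; then the token moves to $x_{k+1}=x_k+\epsilon v$ or $x_{k+1}=x_k-\epsilon v$, each with probability $1/2$. The game ends at the first time $\tau$ at which $x_\tau\notin\Omega$, and the final payoff is $g(x_\tau)$: Player I gets $-g(x_\tau)$ and Player II gets $g(x_\tau)$. If the starting point $x_0$ is not in $\Omega$, then $\tau=0$. A strategy $S_I$ for Player I is a function assigning to each partial history $(x_0,\dots,x_k)$ a $j$-dimensional subspace; a strategy $S_{II}$ for Player II is a function assigning to each $(x_0,\dots,x_k,S)$, with $S$ a $j$-dimensional subspace, a unit vector $v\in S$.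 Fixed strategies and a starting point $x_0$ determine (by the one-step transition probabilities and Kolmogorov's extension theorem) a probability measure on game sequences, whose expectation is denoted $\mathbb{E}^{x_0}_{S_I,S_{II}}$; the game ends almost surely. The values are $$u^\epsilon_I(x_0)=\inf_{S_I}\sup_{S_{II}}\mathbb{E}^{x_0}_{S_I,S_{II}}[g(x_\tau)],\qquad u^\epsilon_{II}(x_0)=\sup_{S_{II}}\inf_{S_I}\mathbb{E}^{x_0}_{S_I,S_{II}}[g(x_\tau)].$$ The game is said to have a value if $u^\epsilon_I=u^\epsilon_{II}$. *)

(* Defs.v *)
From HB Require Import structures.
From mathcomp Require Import all_boot all_order all_algebra.
From mathcomp Require Import all_classical all_reals all_analysis.
From mathcomp Require Import zify ring lra.
Set Implicit Arguments.
Unset Strict Implicit.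
Unset Printing Implicit Defensive.
Import Order.TTheory GRing.Theory Num.Theory numFieldNormedType.Exports.
Local Open Scope classical_set_scope.
Local Open Scope ring_scope.

Section Game.
Variables (R : realType) (N : nat).
Local Notation point := 'rV[R]_N.

(* The library norm on matrices is the sup norm. *)
Definition enorm (v : point) : R := Num.sqrt (\sum_i v 0 i ^+ 2).

Definition domain (Omega : set point) : Prop :=
  [/\ Omega !=set0, open Omega & connected Omega].

Definition subspaces (j : nat) : set {vspace point} := [set S | \dim S = j].

Definition unit_vectors (S : {vspace point}) : set point :=
  [set v | v \in S /\ enorm v = 1].

(* A history (x_0, ..., x_k) is the sequence [:: x_0; ...; x_k]; the value of
   a strategy at the empty sequence, and that of a strategy of Player II at a
   subspace of dimension other than j, are never used. *)
Definition strategyI (j : nat) : set (seq point -> {vspace point}) :=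
  [set sI | forall h, subspaces j (sI h)].

Definition strategyII (j : nat) : set (seq point -> {vspace point} -> point) :=
  [set sII | forall h S, subspaces j S -> unit_vectors S (sII h S)].

Definition cylinders : set (set (nat -> point)) :=
  [set B | exists k A, open A /\ B = [set w | A (w k)]].

Definition paths := g_sigma_algebraType cylinders.

Definition borel := g_sigma_algebraType (@open point).

Section Law.
Variables (Omega : set point) (eps : R).
Variables (sI : seq point -> {vspace point}).
Variables (sII : seq point -> {vspace point} -> point).

(* One-step transition probability from the history h; once outside Omega the
   token stays put, so that a play is an infinite sequence. *)
Definition transition (h : seq point) (A : set borel) : \bar R :=
  let x := last 0 h in
  let v := sII h (sI h) in
  let xp : borel := x + eps *: v in
  let xm : borel := x - eps *: v in
  if x \in Omega then ((2^-1)%:E * \d_xp A + (2^-1)%:E * \d_xm A)%E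
  else \d_(x : borel) A.

(* Strategies are arbitrary functions, so transition need not be measurable in
   h; conditioning on the exact history suffices because the law of
   (x_0, ..., x_k) has finite support, and this determines P. *)
Definition is_game_law (x0 : point) (P : probability paths R) : Prop :=
  P [set w : paths | w 0%N = x0] = 1%E /\
  forall (h : seq point) (A : set borel), (0 < size h)%N -> measurable A ->
    P [set w : paths | mkseq w (size h) = h /\ A (w (size h))] =
    (P [set w : paths | mkseq w (size h) = h] * transition h A)%E.


(* Existence: the law is the image of the uniform law on [0, 1], whose dyadic
   digits are independent fair coins. *)
Let nxt (h : seq point) (b : bool) : point :=
  let x := last 0 h in let v := sII h (sI h) in
  if x \in Omega then (if b then x - eps *: v else x + eps *: v) else x.

Let Fixpoint hist (x0 : point) (k m : nat) : seq point :=
  if k is k'.+1 then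
    let h := hist x0 k' m./2 in rcons h (nxt h (odd m))
  else [:: x0].

Let digits (k : nat) (t : measurableTypeR R) : nat :=
  Num.truncn (2 ^+ k * t).

Let digitsS k t : (digits k.+1 t)./2 = digits k t.
Proof.
apply/eqP; rewrite /digits eqn_leq; apply/andP; split.
  rewrite leq_half_double truncn_le_nat exprS -mulrA.
  by rewrite -doubleS -muln2 natrM mulrC ltr_pM2r// truncnS_gt.
rewrite geq_half_double.
have [t0|t0] := leP 0 t; last first.
  have /eqP -> : Num.truncn (2 ^+ k * t) == 0%N.
    by rewrite -leqn0 truncn_le_nat (lt_trans _ ltr01)// pmulr_rlt0// exprn_gt0.
  by [].
rewrite truncn_ge_nat ?mulr_ge0 ?exprn_ge0// -muln2 natrM mulrC exprS -mulrA.
by rewrite ler_pM2l// truncn_le mulr_ge0// exprn_ge0.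
Qed.

Let measurable_digits k : measurable_fun setT (digits k).
Proof.
move=> _ Q _; rewrite setTI.
have -> : digits k @^-1` Q = \bigcup_(m in Q) digits k @^-1` [set m].
  apply/seteqP; split=> [t Qt|t [m Qm]]; first by exists (digits k t).
  by rewrite /preimage/= => ->.
apply: bigcup_measurable => m _.
have digit_le n : measurable [set t : measurableTypeR R | (digits k t <= n)%N].
  rewrite (_ : mkset _ = [set` `]-oo, n.+1%:R / 2 ^+ k[ ])//.
  apply/seteqP; split=> t /=; rewrite in_itv/= truncn_le_nat ltr_pdivlMr ?exprn_gt0//;
    by rewrite mulrC.
case: m => [|m].
  rewrite (_ : _ @^-1` _ = [set t | (digits k t <= 0)%N])//.
  by apply/seteqP; split=> t /=; rewrite leqn0 => /eqP.
rewrite (_ : _ @^-1` _ = [set t | (digits k t <= m.+1)%N] `\`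
                        [set t | (digits k t <= m)%N]).
  exact: measurableD.
apply/seteqP; split=> t /=; first by move=> ->; rewrite leqnn ltnn.
by case=> + /negP; lia.
Qed.

Let path (x0 : point) (t : measurableTypeR R) : paths :=
  fun k => last x0 (hist x0 k (digits k t)).

Let measurable_path x0 : measurable_fun setT (path x0).
Proof.
apply: (@measurability _ _ _ paths setT (path x0) cylinders) => //.
move=> _ [_ [k [A [_ ->]] <-]]; rewrite setTI.
rewrite (_ : _ @^-1` _ =
  digits k @^-1` [set m | A (last x0 (hist x0 k m))])//.
by rewrite -[X in measurable X]setTI; exact: measurable_digits.
Qed.

Let U : probability (measurableTypeR R) R := uniform_prob (@ltr01 R).

Let mdigits k Q : measurable (digits k @^-1` Q).
Proof. by rewrite -[X in measurable X]setTI; exact: measurable_digits. Qed.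

Let digits_prob k m : (m < 2 ^ k)%N ->
  U (digits k @^-1` [set m]) = (2 ^- k)%:E.
Proof.
move=> mk; have k0 : (0 : R) < 2 ^+ k by rewrite exprn_gt0.
have k0' := ltW k0.
rewrite /U/= /uniform_prob integral_uniform_pdf.
rewrite (_ : _ `&` _ = [set` `[m%:R / 2 ^+ k, m.+1%:R / 2 ^+ k[]); last first.
  apply/seteqP; split=> t /=; rewrite !in_itv/=.
    case=> tm /andP[t0 t1]; move/eqP: tm.
    rewrite /digits truncn_eq ?mulr_ge0// => /andP[? ?].
    by rewrite ler_pdivrMr// ltr_pdivlMr// ![t * _]mulrC; apply/andP.
  move=> /andP[mt tm].
  have t0 : 0 <= t by rewrite (le_trans _ mt)// divr_ge0.
  split.
    apply/eqP; rewrite /digits truncn_eq ?mulr_ge0//.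
    by rewrite ![_ * t]mulrC -ler_pdivrMr// -ltr_pdivlMr// mt.
  rewrite t0 (le_trans (ltW tm))// ler_pdivrMr// mul1r -natrX ler_nat//.
rewrite (eq_integral (cst 1%E)); last first.
  move=> t; rewrite inE/= in_itv/= => /andP[mt tm]; rewrite /uniform_pdf.
  rewrite ifT ?subr0 ?invr1//.
  rewrite (le_trans _ mt) ?divr_ge0//=.
  by rewrite (le_trans (ltW tm))// ler_pdivrMr// mul1r -natrX ler_nat.
rewrite integral_cst//= mul1e lebesgue_measure_itv/= lte_fin.
rewrite ltr_pM2r ?invr_gt0// ltr_nat ltnSn -EFinB -mulrBl -natrB// subSnn.
by rewrite mul1r.
Qed.

Let digits_sum k Q : U (digits k @^-1` Q) =
  (\sum_(0 <= m < 2 ^ k) (m \in Q)%:R / 2 ^+ k)%:E.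
Proof.
have step K : (K <= 2 ^ k)%N -> forall Q, U (digits k @^-1` (Q `&` `I_K)) =
    (\sum_(0 <= m < K) (m \in Q)%:R / 2 ^+ k)%:E.
  elim: K => [_ {}Q|K IH Kk {}Q].
    by rewrite II0 setI0 preimage_set0 measure0 big_nil.
  rewrite big_nat_recr//= EFinD -IH ?(ltnW Kk)//.
  have -> : Q `&` `I_K.+1 = (Q `&` `I_K) `|` (Q `&` [set K]).
    rewrite -setIUr; congr (_ `&` _); apply/seteqP; split=> n /=.
      by rewrite ltnS leq_eqVlt => /orP[/eqP ->|]; [right|left].
    by move=> [|->]//; lia.
  rewrite preimage_setU measureU; [|exact: mdigits|exact: mdigits|]; last first.
    rewrite -preimage_setI (_ : _ `&` _ = set0) ?preimage_set0//.
    by apply/seteqP; split=> n //= [[_ +] [_ nK]]; rewrite nK ltnn.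
  congr (_ + _)%E; have [KQ|KQ] := boolP (K \in Q).
    rewrite mul1r -(digits_prob Kk) setIidr// => _ ->; exact/set_mem.
  rewrite mul0r (_ : _ `&` _ = set0) ?preimage_set0 ?measure0//.
  apply/seteqP; split=> n //= [Qn nK].
  by rewrite nK in Qn; rewrite (mem_set Qn) in KQ.
have U1 : U (digits k @^-1` `I_(2 ^ k)) = 1%E.
  rewrite -[X in _ @^-1` X]setTI step// (eq_bigr (fun=> 2 ^- k)); last first.
    by move=> m _; rewrite in_setT mul1r.
  by rewrite sumr_const_nat subn0 -[X in X%:E]mulr_natl natrX mulfV// expf_neq0.
have U0 : U (digits k @^-1` (~` `I_(2 ^ k))) = 0%E.
  rewrite preimage_setC probability_setC; last exact: (mdigits k `I_(2 ^ k)).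
  by rewrite U1 subee.
rewrite -step// -[in LHS](setIT Q) -(setUv `I_(2 ^ k)) setIUr preimage_setU.
rewrite measureU; [|exact: mdigits|exact: mdigits|]; last first.
  by rewrite -preimage_setI setIACA setICr setI0 preimage_set0.
rewrite [X in (_ + X)%E](_ : _ = 0%E) ?adde0//.
apply/eqP; rewrite eq_le measure_ge0 andbT -U0.
by apply: le_measure; rewrite ?inE; [exact: mdigits|exact: mdigits|move=> t []].
Qed.

Let path_nxt x0 t k :
  path x0 t k.+1 = nxt (hist x0 k (digits k t)) (odd (digits k.+1 t)).
Proof. by rewrite /path/= digitsS last_rcons. Qed.

Let mkseq_path x0 k t : mkseq (path x0 t) k.+1 = hist x0 k (digits k t).
Proof.
elim: k => [|k IH]//; by rewrite mkseqS IH path_nxt /= digitsS.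
Qed.

Lemma game_law_exists (x0 : point) :
  exists P : probability paths R, is_game_law x0 P.
Proof.
pose X : {mfun (measurableTypeR R) >-> paths} :=
  HB.pack (path x0) (isMeasurableFun.Build _ _ _ _ (path x0) (measurable_path x0)).
exists (distribution U X); split.
  rewrite /distribution/= /pushforward (_ : _ @^-1` _ = setT) ?probability_setT//.
  exact/seteqP.
move=> h A + mA; case hk: (size h) => [//|k] _.
rewrite /distribution/= /pushforward.
pose QA := [set n | hist x0 k n./2 = h /\ A (nxt h (odd n))].
pose Q := [set m | hist x0 k m = h].
rewrite (_ : _ @^-1` _ = digits k.+1 @^-1` QA); last first.
  apply/seteqP; split=> t; rewrite /QA /preimage/= mkseq_path path_nxt digitsS;
    by move=> [->].
rewrite (_ : path x0 @^-1` _ = digits k @^-1` Q); last first.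
  by apply/seteqP; split=> t; rewrite /Q /preimage/= mkseq_path.
have sum2 (f : nat -> R) K : \sum_(0 <= n < 2 * K) f n =
    \sum_(0 <= m < K) (f m.*2 + f m.*2.+1).
  elim: K => [|K IH]; first by rewrite muln0 !big_nil.
  by rewrite mulnS !big_nat_recr//= IH mul2n addrA.
rewrite !digits_sum expnS sum2.
have -> : transition h A = (2^-1 * ((nxt h false \in A)%:R + (nxt h true \in A)%:R))%:E.
  rewrite /transition /nxt; case: ifP => _; rewrite !diracE.
    by rewrite -!EFinM -EFinD mulrDr.
  by congr EFin; lra.
rewrite -EFinM mulr_suml; congr EFin; apply: eq_bigr => m _.
have inQA (b : bool) : ((b + m.*2)%N \in QA) = (m \in Q) && (nxt h b \in A).
  by apply/idP/andP; rewrite !inE /QA/= half_bit_double oddD odd_double addbF oddb//.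
have := inQA false; have := inQA true; rewrite add1n add0n => -> ->.
case: (m \in Q) => /=; last by rewrite !mul0r addr0.
rewrite exprS invfM; ring.
Qed.

Definition game_law (x0 : point) : probability paths R :=
  projT1 (cid (game_law_exists x0)).

End Law.

Section Values.
Variables (j : nat) (Omega : set point) (eps : R) (g : point -> R).

Definition exit_time (w : paths) : option nat :=
  if pselect (exists k, w k \notin Omega) is left ex then Some (ex_minn ex)
  else None.

(* g is only evaluated outside Omega. The plays that never leave Omega, to
   which 0 is assigned, have probability zero. *)
Definition payoff (w : paths) : R :=
  if exit_time w is Some tau then g (w tau) else 0.

Definition expected_payoff sI sII (x0 : point) : \bar R :=
  ('E_(game_law Omega eps sI sII x0) [payoff])%E.

Definition valueI (x0 : point) : \bar R :=
  ereal_inf [set ereal_sup [set expected_payoff sI sII x0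
                           | sII in strategyII j]
            | sI in strategyI j].

Definition valueII (x0 : point) : \bar R :=
  ereal_sup [set ereal_inf [set expected_payoff sI sII x0
                           | sI in strategyI j]
            | sII in strategyII j].

End Values.
End Game.

(* Main.v *)
(* A bounded solution [u] of the dynamic programming equation is obtained from
   Knaster-Tarski, since the game operator is monotone and preserves the bounds
   of [g].  If Player I always picks a subspace that is optimal for [u] up to
   [delta * eps ^+ 2], then [u x - delta * |x| ^ 2] is a supermartingale along the
   play, because [|x| ^ 2] increases by [eps ^+ 2] per round on average;
   symmetrically for Player II.  Hence both values lie within O(delta) of [u].
   Strategies and [u] need not be measurable, so the supermartingale argument is
   run on the tree of histories: one compares the integrals of the payoff over
   the events "the play starts with h" rather than the integrals of [u]. *)
Require Import Defs.
From mathcomp Require Import all_boot all_order all_algebra.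
From mathcomp Require Import all_classical all_reals all_analysis.
From mathcomp Require Import measurable_realfun.
From mathcomp Require Import ring lra zify.
Set Implicit Arguments.
Unset Strict Implicit.
Unset Printing Implicit Defensive.
Import Order.TTheory GRing.Theory Num.Theory numFieldNormedType.Exports.
Local Open Scope classical_set_scope.
Local Open Scope ring_scope.

(** * Euclidean norm, comparison with the sup norm, subspaces and unit vectors *)

Section EuclideanNorm.
Variables (R : realType) (N : nat).
Implicit Types x y v : 'rV[R]_N.

Lemma enorm_sqr v : enorm v ^+ 2 = \sum_i v 0 i ^+ 2.
Proof. by rewrite sqr_sqrtr// sumr_ge0// => i _; rewrite sqr_ge0. Qed.

Lemma enorm_ge0 v : 0 <= enorm v.
Proof. exact: sqrtr_ge0. Qed.

(** Source of the drift: when [y] has length [eps], the mean of the squared norm over the two moves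
    exceeds its value at [x] by exactly [eps ^+ 2], whatever direction is played. *)
Lemma enorm_parallelogram x y :
  enorm (x + y) ^+ 2 + enorm (x - y) ^+ 2 = 2 * (enorm x ^+ 2 + enorm y ^+ 2).
Proof.
rewrite !enorm_sqr -!big_split mulr_sumr /=; apply: eq_bigr => i _.
by rewrite !mxE; ring.
Qed.

Lemma enormZ (a : R) v : enorm (a *: v) = `|a| * enorm v.
Proof.
rewrite /enorm (eq_bigr (fun i => a ^+ 2 * v 0 i ^+ 2)); last first.
  by move=> i _; rewrite !mxE exprMn.
by rewrite -mulr_sumr sqrtrM ?sqr_ge0// sqrtr_sqr.
Qed.

Lemma coord_le_norm v i : `|v 0 i| <= `|v|.
Proof.
rewrite [leRHS]mx_normrE.
exact: (le_bigmax _ (fun ij : 'I_1 * 'I_N => `|v ij.1 ij.2|) (0, i)).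
Qed.

(** Ensures that a move of Euclidean length [eps] leaves a sup-norm ball by at most [eps]. *)
Lemma norm_le_enorm v : `|v| <= enorm v.
Proof.
rewrite [leLHS]mx_normrE; apply/bigmax_leP; split=> [|[i k] _ /=].
  exact: enorm_ge0.
rewrite ord1 -sqrtr_sqr ler_wsqrtr// (bigD1 k)//= lerDl sumr_ge0// => l _.
exact: sqr_ge0.
Qed.

(** Serves to keep the weight, a constant minus the squared Euclidean norm, at least 1 on a sup-norm
    ball. *)
Lemma enorm_sqr_le v : enorm v ^+ 2 <= N%:R * `|v| ^+ 2.
Proof.
rewrite enorm_sqr (le_trans (ler_sum _ (G := fun=> `|v| ^+ 2) _))//.
  by move=> i _; rewrite -real_normK ?num_real// lerXn2r ?nnegrE// coord_le_norm.
by rewrite sumr_const card_ord mulr_natl.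
Qed.

Lemma enorm_eq0 v : (enorm v == 0) = (v == 0).
Proof.
apply/eqP/eqP => [v0|->]; last by rewrite -(scale0r 0) enormZ normr0 mul0r.
by apply/eqP; rewrite -normr_le0 -v0 norm_le_enorm.
Qed.

Lemma subspaces_neq0 j : (j <= N)%N -> @subspaces R N j !=set0.
Proof.
move=> jN; pose X := vbasis {: 'rV[R]_N}.
have sX : size (take j X) = j.
  by rewrite size_take size_tuple dimvf /dim/= mul1n; case: ltngtP jN => // ->.
exists <<take j X>>%VS; rewrite /subspaces /=.
have : free (take j X).
  apply: (@catl_free _ _ (drop j X)); rewrite cat_take_drop.
  exact: basis_free (vbasisP _).
by rewrite /free sX => /eqP.
Qed.

Lemma unit_vectors_neq0 j (S : {vspace 'rV[R]_N}) :
  (0 < j)%N -> subspaces j S -> unit_vectors S !=set0.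
Proof.
move=> j0 dS; have S0 : S != 0%VS.
  by apply/eqP => S0; move: dS; rewrite /subspaces/= S0 dimv0 => j0'; rewrite -j0' in j0.
have v0 : vpick S != 0 by rewrite vpick0.
have e0 : enorm (vpick S) != 0 by rewrite enorm_eq0.
exists ((enorm (vpick S))^-1 *: vpick S); split; first by rewrite memvZ ?memv_pick.
by rewrite enormZ ger0_norm ?invr_ge0 ?enorm_ge0// mulVf.
Qed.

End EuclideanNorm.

(** * The supermartingale estimate on the tree of histories *)

Lemma le_of_geometric (R : realType) (a b c q : R) :
  0 <= q < 1 -> (forall n, a <= b + c * q ^+ n) -> a <= b.
Proof.
move=> /andP[q0 q1] le_ab.
have cv : (b + c * q ^+ n) @[n --> \oo] --> b.
  rewrite -[X in _ --> X]addr0 -(mulr0 c).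
  by apply: cvgD; [exact: cvg_cst|apply: cvgMr; apply: cvg_expr; rewrite ger0_norm].
by rewrite -(cvg_lim _ cv)//; apply: limr_ge; [apply/cvg_ex; exists b|exact: nearW].
Qed.

(* [I h] and [p h] stand for the integral of the payoff over the event that the
   play starts with [h], and for the probability of that event.  Besides the
   slack [delta], the weight [phi] absorbs the error of stopping after [n]
   rounds: its mean decreases by [eps ^+ 2] per round, hence geometrically. *)
Lemma supermartingale_bound (R : realType) (N : nat) (Omega K : set 'rV[R]_N)
    (eps C L delta : R) (I p : seq 'rV[R]_N -> R) (v : seq 'rV[R]_N -> 'rV[R]_N)
    (u phi : 'rV[R]_N -> R) :
  0 < eps -> eps ^+ 2 <= L -> 0 <= C -> 0 <= delta ->
  (forall x, K x -> 1 <= phi x <= L) ->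
  (forall x, K x -> - C <= u x) ->
  (forall h, Omega (last 0 h) ->
     K (last 0 h + eps *: v h) /\ K (last 0 h - eps *: v h)) ->
  (forall h, 0 <= p h) ->
  (forall h, (0 < size h)%N -> Omega (last 0 h) ->
     p (rcons h (last 0 h + eps *: v h)) = p h / 2 /\
     p (rcons h (last 0 h - eps *: v h)) = p h / 2) ->
  (forall h, (0 < size h)%N -> Omega (last 0 h) ->
     I h = I (rcons h (last 0 h + eps *: v h)) +
           I (rcons h (last 0 h - eps *: v h))) ->
  (forall h, (0 < size h)%N -> I h <= C * p h) ->
  (forall h, (0 < size h)%N -> ~ Omega (last 0 h) -> I h = p h * u (last 0 h)) ->
  (forall h, Omega (last 0 h) ->
     u (last 0 h + eps *: v h) + u (last 0 h - eps *: v h) <=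
     2 * (u (last 0 h) + delta * eps ^+ 2)) ->
  (forall h, Omega (last 0 h) ->
     phi (last 0 h + eps *: v h) + phi (last 0 h - eps *: v h) =
     2 * (phi (last 0 h) - eps ^+ 2)) ->
  forall h, (0 < size h)%N -> K (last 0 h) ->
  I h <= p h * (u (last 0 h) + delta * phi (last 0 h)).
Proof.
move=> eps0 epsL C0 delta0 phiK uK stepK p0 pS IS IC Iexit meanu meanphi h0 sh0 Kh0.
have L0 : 0 < L by rewrite (lt_le_trans _ epsL)// exprn_gt0.
(* As [phi <= L] on [K], lowering [phi] by [eps ^+ 2] makes it at most [q * phi]. *)
pose q := 1 - eps ^+ 2 / L.
have q0 : 0 <= q by rewrite subr_ge0 ler_pdivrMr// mul1r.
have q1 : q < 1 by rewrite ltrBlDr ltrDl divr_gt0// exprn_gt0.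
(* The last term pays for stopping after [n] rounds: at [n = 0], [I h <= C * p h], [u >= - C] and
   [phi >= 1], so [2 * C * phi] covers the gap. Each further round multiplies this term by [q]. *)
have bound n h : (0 < size h)%N -> K (last 0 h) -> I h <= p h *
    (u (last 0 h) + delta * phi (last 0 h) + 2 * C * q ^+ n * phi (last 0 h)).
  elim: n h => [|n IHn] h sh Kh.
    have /andP[phi1 _] := phiK _ Kh; have uC := uK _ Kh.
    rewrite expr0 mulr1 (le_trans (IC h sh))// mulrC ler_wpM2l//.
    have : 0 <= delta * phi (last 0 h) by rewrite mulr_ge0// (le_trans ler01).
    have : 0 <= C * (phi (last 0 h) - 1) by rewrite mulr_ge0// subr_ge0.
    lra.
  have /andP[phi1 phiL] := phiK _ Kh.
  have phi0 : 0 <= phi (last 0 h) by rewrite (le_trans ler01).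
  have [Oh|Oh] := pselect (Omega (last 0 h)); last first.
    rewrite Iexit// ler_wpM2l// -addrA lerDl addr_ge0// mulr_ge0//.
    by rewrite mulr_ge0 ?exprn_ge0// mulr_ge0.
  have [Kp Km] := stepK _ Oh; have [pp pm] := pS _ sh Oh.
  rewrite IS//.
  have := IHn (rcons h (last 0 h + eps *: v h)).
  have := IHn (rcons h (last 0 h - eps *: v h)).
  rewrite !size_rcons !last_rcons pp pm => /(_ erefl Km) Im /(_ erefl Kp) Ip.
  rewrite (le_trans (lerD Ip Im))//.
  have mu := meanu _ Oh; have mphi := meanphi _ Oh.
  have qphi : phi (last 0 h) - eps ^+ 2 <= q * phi (last 0 h).
    rewrite mulrBl mul1r lerB// -mulrA ler_piMr ?sqr_ge0//.
    by rewrite mulrC ler_pdivrMr// mul1r.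
  have c0 : 0 <= 2 * C * q ^+ n by rewrite mulr_ge0 ?exprn_ge0// mulr_ge0.
  move: mu mphi Ip Im.
  set xp := last 0 h + _; set xm := last 0 h - _; set c := 2 * C * q ^+ n in c0 *.
  move=> mu mphi _ _.
  rewrite -mulrDr -[p h / 2 * _]mulrA ler_wpM2l//.
  have cphi := ler_wpM2l c0 qphi.
  have -> : 2 * C * q ^+ n.+1 * phi (last 0 h) = c * (q * phi (last 0 h)).
    by rewrite /c exprSr; ring.
  have -> : u xp + delta * phi xp + c * phi xp + (u xm + delta * phi xm + c * phi xm)
    = (u xp + u xm) + (delta + c) * (phi xp + phi xm) by ring.
  by rewrite mphi; lra.
apply: (@le_of_geometric _ _ _ (p h0 * (2 * C * phi (last 0 h0))) q).
  by rewrite q0.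
by move=> n; rewrite (le_trans (bound n _ sh0 Kh0))// !mulrDr; lra.
Qed.

(** * The dynamic programming operator and its fixed point *)

Section FixedPoint.
Variables (R : realType) (N j : nat) (Omega K : set 'rV[R]_N) (eps C : R).
Variable g : 'rV[R]_N -> R.

Definition mean_value (w : 'rV[R]_N -> R) (x v : 'rV[R]_N) : R :=
  2^-1 * w (x + eps *: v) + 2^-1 * w (x - eps *: v).

Definition game_op (w : 'rV[R]_N -> R) (x : 'rV[R]_N) : \bar R :=
  ereal_inf [set ereal_sup [set (mean_value w x v)%:E | v in unit_vectors S]
            | S in subspaces j].

Hypothesis jN : (1 <= j <= N)%N.
Hypothesis stepK : forall x v, Omega x -> enorm v = 1 ->
  K (x + eps *: v) /\ K (x - eps *: v).
Hypothesis C_ge0 : 0 <= C.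
Hypothesis gC : forall x, K x -> ~ Omega x -> `|g x| <= C.

(** The bound is imposed only in [Omega]: outside, [w] is [g], which may be unbounded far away. On
    [K] the bound follows from the one on [g]. *)
Definition admissible (w : 'rV[R]_N -> R) :=
  (forall x, Omega x -> `|w x| <= C) /\ (forall x, ~ Omega x -> w x = g x).

Lemma admissible_bounded w x : admissible w -> K x -> `|w x| <= C.
Proof.
move=> [wO wg] Kx; have [Ox|Ox] := pselect (Omega x); first exact: wO.
by rewrite wg// gC.
Qed.

(** A move from [Omega] lands in [K], where [w] is within [C], so every average is too. Existence of
    a subspace of dimension [j] and of a unit vector in it keeps the infimum and supremum finite. *)
Lemma game_op_bounded w x : admissible w -> Omega x ->
  ((- C)%:E <= game_op w x <= C%:E)%E.
Proof.
move=> aw Ox; have /andP[j0 jleN] := jN.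
have mC v : enorm v = 1 -> - C <= mean_value w x v <= C.
  move=> v1; have [Kp Km] := stepK Ox v1.
  have /ler_normlP[? ?] := admissible_bounded aw Kp.
  have /ler_normlP[? ?] := admissible_bounded aw Km.
  by rewrite /mean_value; lra.
apply/andP; split.
  apply: le_ereal_inf_tmp => _ [S Sj <-].
  have [v [vS v1]] := unit_vectors_neq0 j0 Sj.
  apply: le_ereal_sup_tmp; exists (mean_value w x v)%:E; first by exists v.
  by rewrite lee_fin; have /andP[] := mC _ v1.
have [S Sj] := @subspaces_neq0 R N _ jleN.
apply: ge_ereal_inf; eexists; first by exists S.
apply: ge_ereal_sup => _ [v [_ v1] <-].
by rewrite lee_fin; have /andP[] := mC _ v1.
Qed.

Lemma game_op_mono w w' x : (forall y, w y <= w' y) ->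
  (game_op w x <= game_op w' x)%E.
Proof.
move=> ww'; apply: le_ereal_inf_tmp => _ [S Sj <-].
apply: ge_ereal_inf; eexists; first by exists S.
apply: ge_ereal_sup => _ [v vS <-].
apply: le_ereal_sup_tmp; exists (mean_value w' x v)%:E; first by exists v.
by rewrite lee_fin lerD// ler_wpM2l// invr_ge0.
Qed.

Let subsolution w :=
  admissible w /\ forall x, Omega x -> ((w x)%:E <= game_op w x)%E.

(* Knaster-Tarski: the largest subsolution of a monotone operator is a fixed
   point.  No regularity of the solution is needed. *)
Lemma game_op_fixpoint : exists u, admissible u /\
  forall x, Omega x -> (u x)%:E = game_op u x.
Proof.
pose A x := [set w x | w in subsolution].
have Aub x : Omega x -> ubound (A x) C.
  by move=> Ox _ [w [[wO _] _] <-]; have /ler_normlP[] := wO x Ox.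
(* The least admissible function is a subsolution, so the suprema below are over nonempty sets. *)
pose w0 x := if x \in Omega then - C else g x.
have subw0 : subsolution w0.
  have aw0 : admissible w0.
    split=> x Ox; first by rewrite /w0 mem_set// normrN ger0_norm.
    by rewrite /w0 memNset.
  split=> // x Ox; rewrite {1}/w0 mem_set//.
  by have /andP[] := game_op_bounded aw0 Ox.
pose u x := if x \in Omega then sup (A x) else g x.
have le_u w y : subsolution w -> w y <= u y.
  move=> sw; rewrite /u; case: ifPn => [/set_mem Oy|/negP Oy].
    by apply: ub_le_sup; [exists C; exact: Aub|exists w].
  by have [[_ ->]] := sw => // Oy'; apply: Oy; exact: mem_set.
have au : admissible u.
  split=> x Ox; last by rewrite /u memNset.
  rewrite ler_norml; apply/andP; split.
    by apply: le_trans (le_u _ x subw0); rewrite /w0 mem_set.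
  by rewrite /u mem_set//; apply: ge_sup; [exists (w0 x); exists w0|exact: Aub].
have u_sub x : Omega x -> ((u x)%:E <= game_op u x)%E.
  move=> Ox; have /andP[opl opu] := game_op_bounded au Ox.
  have opf : game_op u x \is a fin_num.
    by rewrite fin_numE; apply/andP; split; apply/eqP => opE; rewrite opE in opl opu.
  rewrite -(fineK opf) lee_fin {1}/u mem_set//.
  apply: ge_sup; first by exists (w0 x); exists w0.
  move=> _ [w [aw sw] <-]; rewrite -lee_fin fineK//.
  by apply: le_trans (sw x Ox) _; apply: game_op_mono => y; exact: le_u.
exists u; split=> // x Ox; apply/eqP; rewrite eq_le u_sub//=.
(* The image of [u] under the operator. Since [u <= w1], monotonicity makes [w1] a subsolution,
   hence [w1 <= u], which is the missing inequality. *)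
pose w1 y := if y \in Omega then fine (game_op u y) else g y.
have w1E y : Omega y -> (w1 y)%:E = game_op u y.
  move=> Oy; rewrite /w1 mem_set// fineK//.
  have /andP[opl opu] := game_op_bounded au Oy.
  by rewrite fin_numE; apply/andP; split; apply/eqP => opE; rewrite opE in opl opu.
have aw1 : admissible w1.
  split=> y Oy; last by rewrite /w1 memNset.
  have /andP[opl opu] := game_op_bounded au Oy.
  by rewrite ler_norml -!lee_fin w1E// opl.
rewrite -w1E// lee_fin; apply: le_u; split=> // y Oy; rewrite w1E//.
apply: game_op_mono => z; have [Oz|Oz] := pselect (Omega z).
  by rewrite -lee_fin w1E// u_sub.
by rewrite (proj2 au)// (proj2 aw1).
Qed.

End FixedPoint.

(** * Cylinder events, measurability of the payoff, and legal plays *)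

Section Paths.
Variables (R : realType) (N : nat).
Local Notation point := 'rV[R]_N.
Local Notation paths := (paths R N).

Lemma open_borel (A : set (borel R N)) : @open point A -> measurable A.
Proof. by move=> oA; exact: sub_sigma_algebra. Qed.

Lemma point_borel (x : point) : measurable ([set x] : set (borel R N)).
Proof.
rewrite -[X in measurable X]setCK; apply: measurableC.
apply: open_borel; rewrite openC.
by apply: accessible_closed_set1; exact/hausdorff_accessible/norm_hausdorff.
Qed.

Lemma measurable_coord (k : nat) (A : set (borel R N)) : measurable A ->
  measurable [set w : paths | A (w k)].
Proof.
move=> mA; have : measurable_fun (setT : set paths) (fun w => w k : borel R N).
  apply: (@measurability _ _ paths (borel R N) setT (fun w => w k) (@open point)).
    by [].
  move=> _ [B oB <-]; rewrite setTI.
  by apply: sub_sigma_algebra; exists k, B.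
by move=> /(_ measurableT A mA); rewrite setTI.
Qed.

Definition cyl (h : seq point) : set paths := [set w | mkseq w (size h) = h].

Lemma cyl_rcons h y : cyl (rcons h y) = cyl h `&` [set w | w (size h) = y].
Proof.
apply/seteqP; split=> w; rewrite /cyl/= size_rcons mkseqS.
  by move=> /rcons_inj[].
by move=> [-> ->].
Qed.

Lemma measurable_cyl h : measurable (cyl h).
Proof.
elim/last_ind: h => [|h y mh].
  by rewrite (_ : cyl _ = setT)//; exact/seteqP.
rewrite cyl_rcons; apply: measurableI => //.
exact: (measurable_coord _ (point_borel y)).
Qed.

Lemma cyl_last h w : (0 < size h)%N -> cyl h w -> w (size h).-1 = last 0 h.
Proof.
elim/last_ind: h => // h y _ _; rewrite cyl_rcons size_rcons last_rcons /=.
by case.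
Qed.

(** The paths are split by their first exit time. On each piece the payoff is [g] at a fixed
    coordinate lying outside [Omega], where continuity of [g] in the subspace topology gives
    measurability; on paths that never exit it is 0. *)
Lemma measurable_fun_payoff (Omega : set point) (g : point -> R) :
  open Omega -> {within ~` Omega, continuous g} ->
  measurable_fun setT (payoff Omega g : paths -> R).
Proof.
move=> oO /continuousP cg.
have mO k : measurable [set w : paths | Omega (w k)].
  by apply: measurable_coord; exact: open_borel.
have mnO : measurable (~` Omega : set (borel R N)).
  by apply: measurableC; exact: open_borel.
have mg : measurable_fun (~` Omega : set (borel R N)) g.
  apply: (measurability _ (RGenOpens.measurableE R)).
  move=> _ [_ [a [b ->] <-]].
  have /cg/open_subspaceP[V oV VE] : open `]a, b[%classic by exact: interval_open.
  by rewrite setIC -VE; apply: measurableI => //; exact: open_borel.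
pose E k := [set w : paths | ~ Omega (w k) /\ forall i, (i < k)%N -> Omega (w i)].
pose F := [set w : paths | forall k, Omega (w k)].
have mE k : measurable (E k).
  have -> : E k = ~` [set w | Omega (w k)] `&`
      \bigcap_(i in `I_k) [set w | Omega (w i)].
    by apply/seteqP; split=> w [nOk Oi]; split.
  by apply: measurableI; [exact: measurableC|exact: bigcap_measurableType].
have mF : measurable F.
  have -> : F = \bigcap_k [set w | Omega (w k)].
    by apply/seteqP; split=> w Fw k; [move=> _|]; exact: Fw.
  exact: bigcapT_measurable.
(* Index 0 carries the paths that never exit, index [k.+1] those that first exit at time [k]. *)
have -> : setT = \bigcup_i (if i is k.+1 then E k else F).
  apply/seteqP; split=> // w _.
  have [ex|nex] := pselect (exists k, w k \notin Omega).
    exists (ex_minn ex).+1 => //; case: ex_minnP => m mw minm; split.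
      by move=> Om; rewrite mem_set in mw.
    move=> i im; apply: contrapT => nOi; have := minm i.
    by rewrite memNset// => /(_ erefl); rewrite leqNgt im.
  by exists 0%N => // k; apply: contrapT => nO; apply: nex; exists k; rewrite memNset.
apply/measurable_fun_bigcup => [[|k]//|[|k]].
  apply: (eq_measurable_fun (fun _ : paths => 0 : R)) => // w /set_mem Fw.
  rewrite /payoff /exit_time; case: pselect => // -[k nOk].
  by exfalso; rewrite mem_set in nOk.
apply: (eq_measurable_fun (g \o (fun w : paths => w k : borel R N))).
  move=> w /set_mem[nOk Oi]; rewrite /payoff /exit_time /=; case: pselect => [ex|[]].
    case: ex_minnP => m mw minm; congr (g (w _)).
    have mk : (m <= k)%N by apply: minm; rewrite memNset.
    apply/eqP; rewrite eq_sym eqn_leq mk /= leqNgt; apply/negP => /Oi Om.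
    by rewrite mem_set in mw.
  by exists k; rewrite memNset.
apply: (measurable_comp mnO) => //; first by move=> _ [w [nO _] <-].
move=> mEk B mB; apply: measurableI => //.
exact: measurable_coord.
Qed.

(** The trace that any pair of strategies leaves on almost every path: the direction is forgotten,
    and the length of each move and the freezing outside [Omega] are kept. *)
Definition legal (Omega : set point) (eps : R) (w : paths) :=
  forall k, (Omega (w k) -> enorm (w k.+1 - w k) = eps) /\
            (~ Omega (w k) -> w k.+1 = w k).

(** A legal path is frozen from its first exit on, so its position at the later time [k] is still
    the exit point. *)
Lemma payoff_stopped Omega eps (g : point -> R) (w : paths) k :
  legal Omega eps w -> ~ Omega (w k) -> payoff Omega g w = g (w k).
Proof.
move=> lw nOk; rewrite /payoff /exit_time; case: pselect => [ex|[]]; last first.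
  by exists k; rewrite memNset.
case: ex_minnP => m mw minm.
have mk : (m <= k)%N by apply: minm; rewrite memNset.
have nOm : ~ Omega (w m) by move=> Om; rewrite mem_set in mw.
congr g; rewrite -(subnKC mk); elim: (k - m)%N => [|i IHi]; first by rewrite addn0.
by rewrite addnS (proj2 (lw _)) -IHi.
Qed.

Lemma payoff_bounded (Omega K : set point) eps C (g : point -> R) (w : paths) :
  0 <= C -> (forall x y, Omega x -> enorm (y - x) = eps -> K y) ->
  (forall x, K x -> ~ Omega x -> `|g x| <= C) ->
  legal Omega eps w -> K (w 0%N) -> `|payoff Omega g w| <= C.
Proof.
move=> C0 stepK gC lw K0.
have Kw k : K (w k).
  elim: k => // k Kk; have [lO lnO] := lw k.
  have [Ok|nOk] := pselect (Omega (w k)); last by rewrite lnO.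
  exact: stepK Ok (lO Ok).
rewrite /payoff /exit_time; case: pselect => [ex|_]; last by rewrite normr0.
case: ex_minnP => m mw _; apply: gC => // Om.
by rewrite mem_set in mw.
Qed.

End Paths.

(** * Masses of cylinders and almost sure legality under the law of the game *)

Section LawOfPlay.
Variables (R : realType) (N : nat) (Omega : set 'rV[R]_N) (eps : R).
Variables (sI : seq 'rV[R]_N -> {vspace 'rV[R]_N}).
Variables (sII : seq 'rV[R]_N -> {vspace 'rV[R]_N} -> 'rV[R]_N).
Variables (x0 : 'rV[R]_N) (P : probability (paths R N) R).
Hypothesis eps_gt0 : 0 < eps.
Hypothesis lawP : is_game_law Omega eps sI sII x0 P.
Let v h := sII h (sI h).
Hypothesis v_unit : forall h, enorm (v h) = 1.

Local Notation xp h := (last 0 h + eps *: v h).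
Local Notation xm h := (last 0 h - eps *: v h).

(** If the two moves coincided, a single extension of [h] would carry the whole mass instead of half
    of it. *)
Let xp_neq_xm h : xp h != xm h.
Proof.
rewrite -subr_eq0 opprB addrC addrA subrK -scalerDl -enorm_eq0 enormZ v_unit mulr1.
by rewrite normr_eq0 lt0r_neq0// addr_gt0.
Qed.

Let in_point (x y : 'rV[R]_N) : (x \in [set y]) = (x == y).
Proof. by apply/idP/eqP => [/set_mem|->]; last exact: mem_set. Qed.

Definition mass (h : seq 'rV[R]_N) : R := fine (P (cyl h)).

Lemma mass_ge0 h : 0 <= mass h.
Proof. exact: fine_ge0. Qed.

Lemma massE h : P (cyl h) = (mass h)%:E.
Proof. by rewrite fineK// fin_num_measure//; exact: measurable_cyl. Qed.

Let cyl_lty h : (P (cyl h) < +oo)%E.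
Proof. by rewrite massE ltry. Qed.

Lemma mass_rcons h y : (0 < size h)%N ->
  P (cyl (rcons h y)) = (P (cyl h) * transition Omega eps sI sII h [set y])%E.
Proof.
move=> h0; rewrite cyl_rcons -(proj2 lawP h [set y] h0)//; exact: point_borel.
Qed.

Lemma mass_step h : (0 < size h)%N -> Omega (last 0 h) ->
  mass (rcons h (xp h)) = mass h / 2 /\ mass (rcons h (xm h)) = mass h / 2.
Proof.
move=> h0 Oh; rewrite /mass !mass_rcons// massE /transition mem_set//.
rewrite -/(v h) !diracE !in_point !eqxx (negPf (xp_neq_xm h)) eq_sym.
rewrite (negPf (xp_neq_xm h)) /=.
by rewrite !mulr1 !mulr0 addr0 add0r.
Qed.

Lemma mass_start : mass [:: x0] = 1.
Proof.
rewrite /mass (_ : cyl _ = [set w | w 0%N = x0]) ?(proj1 lawP)//.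
by apply/seteqP; split=> w; rewrite /cyl/=; [case|move=> <-].
Qed.

(** The two extensions are disjoint and each carries half the mass of [h], so nothing remains. *)
Lemma cyl_split_null h : (0 < size h)%N -> Omega (last 0 h) ->
  P (cyl h `\` (cyl (rcons h (xp h)) `|` cyl (rcons h (xm h)))) = 0%E.
Proof.
move=> h0 Oh; have [pp pm] := mass_step h0 Oh.
have sub y : cyl (rcons h y) `<=` cyl h by move=> w; rewrite cyl_rcons => -[].
rewrite measureD; [|exact: measurable_cyl|
  by apply: measurableU; exact: measurable_cyl|exact: cyl_lty].
rewrite setIidr; last by move=> w [|] /sub.
rewrite measureU; [|exact: measurable_cyl|exact: measurable_cyl|].
  rewrite /= !massE pp pm.
  by rewrite -[LHS]/(mass h - (mass h / 2 + mass h / 2))%:E -splitr subrr.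
apply/seteqP; split=> w //; rewrite !cyl_rcons => -[[_ /= ->] [_ /=]] /eqP.
by rewrite (negPf (xp_neq_xm h)).
Qed.

Lemma cyl_stay_null h : (0 < size h)%N -> ~ Omega (last 0 h) ->
  P (cyl h `\` cyl (rcons h (last 0 h))) = 0%E.
Proof.
move=> h0 Oh.
rewrite measureD; [|exact: measurable_cyl|exact: measurable_cyl|exact: cyl_lty].
rewrite setIidr; last by move=> w; rewrite cyl_rcons => -[].
rewrite /= mass_rcons// /transition memNset// diracE in_point eqxx mule1 massE.
by rewrite -EFinB subrr.
Qed.

(** There are uncountably many histories, so null events cannot be collected over all of them. The
    induction follows only the tree of moves issued from [x0], which has finitely many nodes at each
    depth. *)
Lemma legal_ae : {ae P, forall w, w 0%N = x0 /\ legal Omega eps w}.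
Proof.
pose legal_at w k := (Omega (w k) -> enorm (w k.+1 - w k) = eps) /\
            (~ Omega (w k) -> w k.+1 = w k).
(* One of the [n] moves that follow [h] is illegal. Move [k] goes from [w k] to [w k.+1], so the
   first of them has index [(size h).-1]. *)
pose bad n h := cyl h `&`
  [set w | exists k, (size h <= k.+1 < size h + n)%N /\ ~ legal_at w k].
have bad0 n h : (0 < size h)%N -> P.-negligible (bad n h).
  elim: n h => [|n IHn] h h0.
    rewrite (_ : bad _ _ = set0); first exact: negligible_set0.
    by apply/seteqP; split=> // w [_ [k [+ _]]]; lia.
  (* Once the first move after [h] is known to be legal, the illegal one is among the [n] moves
     after the longer history. *)
  have next w y : cyl (rcons h y) w -> legal_at w (size h).-1 ->
      bad n.+1 h w -> bad n (rcons h y) w.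
    move=> cw lw [_ [k [kh nk]]]; split=> //; exists k; split=> //.
    rewrite size_rcons; suff : k != (size h).-1 by lia.
    by apply/eqP => kE; apply: nk; rewrite kE.
  have at_h w y : cyl (rcons h y) w -> w (size h).-1 = last 0 h /\ w (size h).-1.+1 = y.
    by rewrite cyl_rcons prednK// => -[/(cyl_last h0)-> ->].
  have [Oh|nOh] := pselect (Omega (last 0 h)).
    apply: (negligibleS (A := (cyl h `\` (cyl (rcons h (xp h)) `|` cyl (rcons h (xm h))))
        `|` (bad n (rcons h (xp h)) `|` bad n (rcons h (xm h))))); last first.
      apply: negligibleU; last by apply: negligibleU; apply: IHn; rewrite size_rcons.
      apply/negligibleP; last exact: cyl_split_null.
      by apply: measurableD; [|apply: measurableU]; exact: measurable_cyl.
    move=> w bw; have [cp|ncp] := pselect (cyl (rcons h (xp h)) w).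
      right; left; apply: next => //; rewrite /legal_at; have [-> ->] := at_h _ _ cp.
      by split=> // _; rewrite addrC addKr enormZ v_unit mulr1 gtr0_norm.
    have [cm|ncm] := pselect (cyl (rcons h (xm h)) w).
      right; right; apply: next => //; rewrite /legal_at; have [-> ->] := at_h _ _ cm.
      by split=> // _; rewrite addrC addKr -scaleNr enormZ v_unit mulr1 normrN gtr0_norm.
    by left; split; [case: bw|case].
  apply: (negligibleS (A := (cyl h `\` cyl (rcons h (last 0 h)))
        `|` bad n (rcons h (last 0 h)))); last first.
    apply: negligibleU; last by apply: IHn; rewrite size_rcons.
    apply/negligibleP; last exact: cyl_stay_null.
    by apply: measurableD; exact: measurable_cyl.
  move=> w bw; have [cs|ncs] := pselect (cyl (rcons h (last 0 h)) w).
    by right; apply: next => //; rewrite /legal_at; have [-> ->] := at_h _ _ cs.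
  by left; split=> //; case: bw.
apply: (negligibleS (A := ~` cyl [:: x0] `|` \bigcup_n bad n [:: x0])).
  move=> w nlw; have [cw|ncw] := pselect (cyl [:: x0] w); last by left.
  right; apply: contrapT => nbw; apply: nlw; split.
    by have := cyl_last _ cw; apply.
  move=> k; apply: contrapT => nk; apply: nbw; exists k.+1 => //; split=> //.
  by exists k; split=> //=; lia.
apply: negligibleU; last by apply: negligible_bigcup => n; exact: bad0.
apply/negligibleP; first by apply: measurableC; exact: measurable_cyl.
rewrite -[LHS]/(P (~` cyl [:: x0])) probability_setC; last exact: measurable_cyl.
by rewrite massE mass_start subee.
Qed.

(** * Expected payoff and its bounds by a near-solution of the equation *)

Section ExpectedPayoff.
Variables (g : 'rV[R]_N -> R) (K : set 'rV[R]_N) (C : R).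
Hypothesis openOmega : open Omega.
Hypothesis cg : {within ~` Omega, continuous g}.

Lemma expectation_payoff_outside : ~ Omega x0 ->
  ('E_P [payoff Omega g] = (g x0)%:E)%E.
Proof.
move=> nOx0; rewrite unlock.
rewrite (@ae_eq_integral _ _ _ P setT (cst (g x0)%:E))//.
- by have := expectation_cst P (g x0); rewrite unlock.
- by apply/measurable_EFinP; exact: measurable_fun_payoff.
- apply: (negligibleS _ legal_ae) => w; apply: contra_not => -[w0 lw] _.
  by rewrite (payoff_stopped (k := 0%N) _ lw) w0.
Qed.

Hypothesis C_ge0 : 0 <= C.
Hypothesis stepK : forall x y, Omega x -> enorm (y - x) = eps -> K y.
Hypothesis gC : forall x, K x -> ~ Omega x -> `|g x| <= C.
Hypothesis Kx0 : K x0.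

(* [payoff] is only almost surely bounded. *)
Definition truncated_payoff (w : paths R N) : R :=
  Num.max (- C) (Num.min C (payoff Omega g w)).

Lemma truncated_payoff_le w : `|truncated_payoff w| <= C.
Proof.
rewrite ler_norml /truncated_payoff le_max lexx/= ge_max ge_min lexx/= andbT.
by rewrite (le_trans _ C_ge0)// oppr_le0.
Qed.

Lemma truncated_payoff_id w : `|payoff Omega g w| <= C ->
  truncated_payoff w = payoff Omega g w.
Proof.
rewrite ler_norml /truncated_payoff => /andP[lo up].
by rewrite (min_idPr up) (max_idPr lo).
Qed.

Lemma truncated_payoff_ae : {ae P, forall w,
  legal Omega eps w /\ truncated_payoff w = payoff Omega g w}.
Proof.
apply: (negligibleS _ legal_ae) => w; apply: contra_not => -[w0 lw]; split=> //.
apply: truncated_payoff_id; apply: (payoff_bounded C_ge0 stepK gC lw).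
by rewrite w0.
Qed.

Lemma measurable_truncated_payoff : measurable_fun setT truncated_payoff.
Proof.
apply: measurable_maxr; first exact: measurable_cst.
apply: measurable_minr; first exact: measurable_cst.
exact: measurable_fun_payoff.
Qed.

Lemma integrable_truncated_payoff D : measurable D ->
  P.-integrable D (EFin \o truncated_payoff).
Proof.
move=> mD; apply: measurable_bounded_integrable => //.
- by rewrite ltey_eq fin_num_measure.
- exact: measurable_funTS measurable_truncated_payoff.
- exists C; split; first exact: num_real.
  by move=> M CM w _; exact: le_trans (truncated_payoff_le w) (ltW CM).
Qed.

(** An integral rather than a conditional expectation: it keeps its meaning for histories of mass
    zero and is additive over extensions. *)
Definition partial_payoff (h : seq 'rV[R]_N) : R :=
  \int[P]_(w in cyl h) truncated_payoff w.

Lemma partial_payoff_step h : (0 < size h)%N -> Omega (last 0 h) ->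
  partial_payoff h =
  partial_payoff (rcons h (xp h)) + partial_payoff (rcons h (xm h)).
Proof.
move=> h0 Oh; rewrite /partial_payoff.
have mU : measurable (cyl (rcons h (xp h)) `|` cyl (rcons h (xm h))).
  by apply: measurableU; exact: measurable_cyl.
have mh := measurable_cyl h.
rewrite -Rintegral_setU; [|exact: measurable_cyl|exact: measurable_cyl|
  exact: integrable_truncated_payoff|]; last first.
  apply/disj_setPS => w; rewrite !cyl_rcons => -[[_ /= ->] [_ /=]] /eqP.
  by rewrite (negPf (xp_neq_xm h)).
rewrite /Rintegral; congr fine.
rewrite (negligible_integral (measurableD mh mU) mh)//; last first.
- exact: cyl_split_null.
- exact: integrable_truncated_payoff.
congr (integral _ _ _); rewrite setDD setIidr// => w.
by rewrite !cyl_rcons => -[[]|[]].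
Qed.

Lemma partial_payoff_norm_le h : `|partial_payoff h| <= C * mass h.
Proof.
have mh := measurable_cyl h; have iT := integrable_truncated_payoff mh.
apply: le_trans (le_normr_Rintegral mh iT) _.
rewrite -Rintegral_cst//; apply: le_Rintegral => //.
- exact: (integrable_norm iT).
- exact: finite_measure_integrable_cst.
- by move=> w _; exact: truncated_payoff_le.
Qed.

Lemma partial_payoff_exit h : (0 < size h)%N -> ~ Omega (last 0 h) ->
  partial_payoff h = mass h * g (last 0 h).
Proof.
move=> h0 nOh; have mh := measurable_cyl h.
rewrite mulrC -Rintegral_cst// /partial_payoff /Rintegral; congr fine.
apply: ae_eq_integral => //.
- by apply/measurable_EFinP; exact: measurable_funTS measurable_truncated_payoff.
- apply: (negligibleS _ truncated_payoff_ae) => w; apply: contra_not => -[lw /= ->] cw.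
  by rewrite (payoff_stopped (k := (size h).-1) _ lw) ?cyl_last.
Qed.

(** Almost every play starts at [x0] and has its payoff unchanged by the truncation. *)
Lemma expectation_payoffE :
  ('E_P [payoff Omega g] = (partial_payoff [:: x0])%:E)%E.
Proof.
have mx0 := measurable_cyl [:: x0].
rewrite unlock /partial_payoff /Rintegral fineK; last first.
  by apply: integrable_fin_num => //; exact: integrable_truncated_payoff.
rewrite (@ae_eq_integral _ _ _ P setT (EFin \o truncated_payoff))//.
- rewrite (negligible_integral (measurableC mx0))//; last first.
  + rewrite -[LHS]/(P (~` cyl [:: x0])) probability_setC//.
    by rewrite massE mass_start subee.
  + exact: integrable_truncated_payoff.
  by rewrite setTD setCK.
- by apply/measurable_EFinP; exact: measurable_fun_payoff.
- by apply/measurable_EFinP; exact: measurable_truncated_payoff.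
- by apply: (negligibleS _ truncated_payoff_ae) => w; apply: contra_not => -[_ /= ->].
Qed.

Variables (u phi : 'rV[R]_N -> R) (L delta : R).
Hypothesis delta_ge0 : 0 <= delta.
Hypothesis eps_le_L : eps ^+ 2 <= L.
Hypothesis phiK : forall x, K x -> 1 <= phi x <= L.
Hypothesis uK : forall x, K x -> `|u x| <= C.
Hypothesis ug : forall x, ~ Omega x -> u x = g x.
Hypothesis phi_step : forall x y, Omega x -> enorm y = eps ->
  phi (x + y) + phi (x - y) = 2 * (phi x - eps ^+ 2).

Let stepK_v h : Omega (last 0 h) -> K (xp h) /\ K (xm h).
Proof.
move=> Oh; split; apply: (stepK Oh); rewrite addrC addKr.
  by rewrite enormZ v_unit mulr1 gtr0_norm.
by rewrite -scaleNr enormZ v_unit mulr1 normrN gtr0_norm.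
Qed.

Let phi_step_v h : Omega (last 0 h) ->
  phi (xp h) + phi (xm h) = 2 * (phi (last 0 h) - eps ^+ 2).
Proof.
by move=> Oh; apply: phi_step => //; rewrite enormZ v_unit mulr1 gtr0_norm.
Qed.

Lemma expectation_payoff_le :
  (forall h, Omega (last 0 h) ->
     mean_value eps u (last 0 h) (v h) <= u (last 0 h) + delta * eps ^+ 2) ->
  ('E_P [payoff Omega g] <= (u x0 + delta * phi x0)%:E)%E.
Proof.
move=> mean_u; rewrite expectation_payoffE lee_fin.
have := @supermartingale_bound R N Omega K eps C L delta partial_payoff mass v
  u phi eps_gt0 eps_le_L C_ge0 delta_ge0 phiK _ stepK_v mass_ge0 mass_step
  partial_payoff_step _ _ _ phi_step_v [:: x0] erefl Kx0.
rewrite mass_start mul1r; apply.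
- by move=> x /uK; rewrite ler_norml => /andP[].
- by move=> h _; have := partial_payoff_norm_le h; rewrite ler_norml => /andP[].
- by move=> h h0 nOh; rewrite ug// partial_payoff_exit.
- by move=> h /mean_u; rewrite /mean_value; lra.
Qed.

(** The upper estimate applied to the opposite payoff and to [- u], with the same weight [phi]. *)
Lemma expectation_payoff_ge :
  (forall h, Omega (last 0 h) ->
     u (last 0 h) - delta * eps ^+ 2 <= mean_value eps u (last 0 h) (v h)) ->
  ((u x0 - delta * phi x0)%:E <= 'E_P [payoff Omega g])%E.
Proof.
move=> mean_u; rewrite expectation_payoffE lee_fin.
have := @supermartingale_bound R N Omega K eps C L delta
  (fun h => - partial_payoff h) mass v (fun x => - u x) phi eps_gt0 eps_le_L
  C_ge0 delta_ge0 phiK _ stepK_v mass_ge0 mass_step _ _ _ _ phi_step_v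
  [:: x0] erefl Kx0.
rewrite mass_start mul1r /= => bound.
suff : - partial_payoff [:: x0] <= - u x0 + delta * phi x0 by lra.
apply: bound.
- by move=> x /uK; rewrite ler_norml lerN2 => /andP[].
- by move=> h h0 Oh; rewrite partial_payoff_step// opprD.
- move=> h _; have := partial_payoff_norm_le h.
  by rewrite ler_norml lerNl => /andP[].
- by move=> h h0 nOh; rewrite ug// partial_payoff_exit// mulrN.
- by move=> h /mean_u; rewrite /mean_value; lra.
Qed.

End ExpectedPayoff.

End LawOfPlay.

(** * The two values, through near-optimal strategies *)

(** A closed ball minus the open set [Omega] is compact, and [g] is continuous on it. *)
Lemma bounded_complement_bound (R : realType) (N : nat)
    (Omega : set 'rV[R]_N) (g : 'rV[R]_N -> R) (M : R) :
  open Omega -> {within ~` Omega, continuous g} ->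
  exists2 C, 0 <= C & forall x, `|x| <= M -> ~ Omega x -> `|g x| <= C.
Proof.
move=> oO cg; pose A := [set x : 'rV[R]_N | `|x| <= M] `&` ~` Omega.
have cA : compact A.
  apply: bounded_closed_compact.
    exists M; split=> [|r Mr x [/le_trans le_xM _]]; first exact: num_real.
    exact/le_xM/ltW.
  apply: closedI; last exact: open_closedC.
  have := @closed_comp _ _ (fun x : 'rV[R]_N => `|x|) [set r : R | r <= M].
  by apply; [move=> x _; exact: norm_continuous|exact: closed_le].
have cgA : {within A, continuous g} by apply: continuous_subspaceW cg => x [].
have [C0 [_ gC]] := compact_bounded (continuous_compact cgA cA).
exists (`|C0| + 1); first by rewrite addr_ge0.
move=> x xM nOx; apply: gC; last by exists x.
by rewrite ltr_pwDr// ler_norm.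
Qed.

Lemma valueII_le_valueI (R : realType) (N j : nat) (Omega : set 'rV[R]_N)
    (eps : R) (g : 'rV[R]_N -> R) (x : 'rV[R]_N) :
  (valueII j Omega eps g x <= valueI j Omega eps g x)%E.
Proof.
apply: ge_ereal_sup => _ [sII hII <-]; apply: le_ereal_inf_tmp => _ [sI hI <-].
apply: (@le_trans _ _ (expected_payoff Omega eps g sI sII x)).
  by apply: ereal_inf_lbound; exists sI.
by apply: ereal_sup_ubound; exists sII.
Qed.

Section GameValue.
Variables (R : realType) (N j : nat) (Omega K : set 'rV[R]_N) (eps C L : R).
Variables (g u phi : 'rV[R]_N -> R).
Hypothesis hj : (1 <= j <= N)%N.
Hypothesis eps_gt0 : 0 < eps.
Hypothesis openOmega : open Omega.
Hypothesis cg : {within ~` Omega, continuous g}.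
Hypothesis OmegaK : Omega `<=` K.
Hypothesis stepK : forall x y, Omega x -> enorm (y - x) = eps -> K y.
Hypothesis C_ge0 : 0 <= C.
Hypothesis gC : forall x, K x -> ~ Omega x -> `|g x| <= C.
Hypothesis eps_le_L : eps ^+ 2 <= L.
Hypothesis phiK : forall x, K x -> 1 <= phi x <= L.
Hypothesis phi_step : forall x y, Omega x -> enorm y = eps ->
  phi (x + y) + phi (x - y) = 2 * (phi x - eps ^+ 2).
Hypothesis uC : admissible Omega C g u.
Hypothesis u_fix : forall x, Omega x -> (u x)%:E = game_op j eps u x.

Let uK x : K x -> `|u x| <= C.
Proof. exact: (admissible_bounded gC uC). Qed.

Let L_gt0 : 0 < L.
Proof. by rewrite (lt_le_trans _ eps_le_L)// exprn_gt0. Qed.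

Let strategies_unit (sI : seq 'rV[R]_N -> {vspace 'rV[R]_N}) sII h :
  strategyI j sI -> strategyII j sII -> enorm (sII h (sI h)) = 1.
Proof. by move=> hI hII; have [] := hII h _ (hI h). Qed.

Let gameP sI sII x :
  is_game_law Omega eps sI sII x (game_law Omega eps sI sII x).
Proof. exact: (projT2 (cid _)). Qed.

Let slack e : 0 < e -> 0 < e / L * eps ^+ 2.
Proof. by move=> e0; rewrite mulr_gt0 ?exprn_gt0// divr_gt0. Qed.

Let slack_phi e x : 0 < e -> K x -> e / L * phi x <= e.
Proof.
move=> e0 /phiK/andP[_ phiL].
by rewrite mulrAC ler_pdivrMr// ler_wpM2l// ltW.
Qed.

Lemma valueI_le x : (valueI j Omega eps g x <= (u x)%:E)%E.
Proof.
apply/lee_addgt0Pr => e e0; have /andP[j0 jN] := hj.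
(* A subspace optimal at [y] up to [delta * eps ^+ 2] with [delta = e / L]; as [phi <= L], the final
   error [delta * phi x] is at most [e]. Outside [Omega] any subspace of dimension [j] serves. *)
have /choice[f fP] y : exists S, subspaces j S /\ (Omega y -> forall v,
    unit_vectors S v -> mean_value eps u y v <= u y + e / L * eps ^+ 2).
  have [Oy|nOy] := pselect (Omega y); last first.
    by have [S Sj] := @subspaces_neq0 R N j jN; exists S.
  have : (game_op j eps u y < (u y + e / L * eps ^+ 2)%:E)%E.
    by rewrite -u_fix// lte_fin ltrDl slack.
  move=> /ereal_inf_lt[_ [S Sj <-] lt_u]; exists S; split=> // _ v vS.
  rewrite -lee_fin; apply: le_trans (ltW lt_u).
  by apply: ereal_sup_ubound; exists v.
pose sI (h : seq 'rV[R]_N) := f (last 0 h).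
have hI : strategyI j sI by move=> h; exact: (proj1 (fP _)).
apply: (ge_ereal_inf (x := _)); eexists; first by exists sI.
apply: ge_ereal_sup => _ [sII hII <-].
have hv h := strategies_unit h hI hII.
rewrite /expected_payoff; have [Ox|nOx] := pselect (Omega x); last first.
  rewrite (expectation_payoff_outside eps_gt0 (gameP _ _ _))//.
  by rewrite -EFinD lee_fin (proj2 uC)// lerDl ltW.
apply: (@le_trans _ _ (u x + e / L * phi x)%:E); last first.
  by rewrite -EFinD lee_fin lerD2l slack_phi//; exact: OmegaK.
apply: (expectation_payoff_le eps_gt0 (gameP _ _ _) hv openOmega cg C_ge0 stepK
  gC (OmegaK Ox) _ eps_le_L phiK uK (proj2 uC) phi_step).
- by rewrite ltW// divr_gt0.
- by move=> h Oh; exact: (proj2 (fP _) Oh _ (hII h _ (hI h))).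
Qed.

Lemma valueII_ge x : ((u x)%:E <= valueII j Omega eps g x)%E.
Proof.
apply/lee_addgt0Pr => e e0; have /andP[j0 jN] := hj.
(* Player II answers the announced subspace, so the direction is chosen for each pair of a position
   and a subspace. Since [u y] is an infimum over subspaces, the supremum over each of them is at
   least [u y]. *)
have /choice[f fP] (yS : 'rV[R]_N * {vspace 'rV[R]_N}) : exists v,
    subspaces j yS.2 -> unit_vectors yS.2 v /\ (Omega yS.1 ->
      u yS.1 - e / L * eps ^+ 2 <= mean_value eps u yS.1 v).
  case: yS => y S /=; have [Sj|nSj] := pselect (subspaces j S); last by exists 0.
  have [Oy|nOy] := pselect (Omega y); last first.
    by have [v vS] := unit_vectors_neq0 j0 Sj; exists v.
  have : ((u y - e / L * eps ^+ 2)%:E <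
      ereal_sup [set (mean_value eps u y v)%:E | v in unit_vectors S])%E.
    apply: (@lt_le_trans _ _ (u y)%:E).
      by rewrite lte_fin gtrBl slack.
    by rewrite u_fix//; apply: ereal_inf_lbound; exists S.
  move=> /ereal_sup_gt[_ [v vS <-] lt_u]; exists v => _; split=> // _.
  by rewrite -lee_fin ltW.
pose sII (h : seq 'rV[R]_N) S := f (last 0 h, S).
have hII : strategyII j sII by move=> h S Sj; exact: (proj1 (fP (_, S) Sj)).
rewrite -leeBlDr//.
apply: le_ereal_sup_tmp; eexists; first by exists sII.
apply: le_ereal_inf_tmp => _ [sI hI <-].
have hv h := strategies_unit h hI hII.
rewrite /expected_payoff; have [Ox|nOx] := pselect (Omega x); last first.
  rewrite (expectation_payoff_outside eps_gt0 (gameP _ _ _))//.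
  by rewrite -EFinB lee_fin (proj2 uC)// gerBl ltW.
apply: (@le_trans _ _ (u x - e / L * phi x)%:E).
  by rewrite -EFinB lee_fin lerD2l lerN2 slack_phi//; exact: OmegaK.
apply: (expectation_payoff_ge eps_gt0 (gameP _ _ _) hv openOmega cg C_ge0 stepK
  gC (OmegaK Ox) _ eps_le_L phiK uK (proj2 uC) phi_step).
- by rewrite ltW// divr_gt0.
- by move=> h Oh; exact: (proj2 (fP (_, sI h) (hI h))).
Qed.

(** The chain [u <= valueII <= valueI <= u] closes. *)
Lemma valueIE x : valueI j Omega eps g x = (u x)%:E.
Proof.
apply/eqP; rewrite eq_le valueI_le /=.
exact: le_trans (valueII_ge x) (valueII_le_valueI _ _ _ _ _).
Qed.

Lemma valueIIE x : valueII j Omega eps g x = (u x)%:E.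
Proof.
apply/eqP; rewrite eq_le valueII_ge andbT.
exact: le_trans (valueII_le_valueI _ _ _ _ _) (valueI_le x).
Qed.

End GameValue.

(** * Choice of the constants and conclusion *)

Unset Implicit Arguments.

Theorem theorem3 (R : realType) (N j : nat) (Omega : set 'rV[R]_N) (eps : R)
    (g : 'rV[R]_N -> R) (domOmega : domain Omega)
    (bndOmega : bounded_set Omega) (hj : (1 <= j <= N)%N) (heps : 0 < eps)
    (cg : {within ~` Omega, continuous g}) :
  exists u : 'rV[R]_N -> R,
    [/\ forall x, valueI j Omega eps g x = (u x)%:E,
        forall x, valueII j Omega eps g x = (u x)%:E,
        forall x, Omega x ->
          (u x)%:E =
          ereal_inf [set ereal_sup
                           [set (2^-1 * u (x + eps *: v)
                                 + 2^-1 * u (x - eps *: v))%:E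
                           | v in unit_vectors S]
                    | S in subspaces j]
      & forall x, ~ Omega x -> u x = g x].
Proof.
have [_ oO _] := domOmega.
have [M0 [_ OM0]] := bndOmega.
(* [M1] bounds [Omega] in sup norm; the extra [eps] makes the ball [K] contain every position
   reached by one move from [Omega]. *)
pose M1 := `|M0| + 1; pose M := M1 + eps.
have OM x : Omega x -> `|x| <= M1.
  by move=> Ox; apply: OM0 => //; rewrite ltr_pwDr// ler_norm.
pose K := [set x : 'rV[R]_N | `|x| <= M].
have OK : Omega `<=` K.
  by move=> x /OM xM; apply: le_trans xM _; rewrite lerDl ltW.
have stepK x y : Omega x -> enorm (y - x) = eps -> K y.
  move=> /OM xM1 yx; rewrite /K /= -(subrK x y) addrC.
  by rewrite (le_trans (ler_normD _ _))// lerD// -yx norm_le_enorm.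
have stepKv x v : Omega x -> enorm v = 1 -> K (x + eps *: v) /\ K (x - eps *: v).
  move=> Ox v1; split; apply: (stepK x) => //; rewrite addrC addKr.
    by rewrite enormZ v1 mulr1 gtr0_norm.
  by rewrite -scaleNr enormZ v1 mulr1 normrN gtr0_norm.
have [C C0 gC] := bounded_complement_bound M oO cg.
have [u [uC u_fix]] := game_op_fixpoint hj stepKv C0 gC.
(* [N%:R * M ^+ 2] bounds the squared Euclidean norm on [K], and the added 1 gives [phi >= 1]
   there. *)
pose L := N%:R * M ^+ 2 + 1.
pose phi (x : 'rV[R]_N) := L - enorm x ^+ 2.
have N1 : (1 : R) <= N%:R by rewrite ler1n; lia.
have M_eps : eps <= M by rewrite lerDr addr_ge0.
have epsL : eps ^+ 2 <= L.
  have e2 : eps ^+ 2 <= M ^+ 2 by rewrite lerXn2r ?nnegrE// ltW// (lt_le_trans heps).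
  have : 0 <= (N%:R - 1) * M ^+ 2 by rewrite mulr_ge0 ?sqr_ge0// subr_ge0.
  by rewrite /L; lra.
have phiK x : K x -> 1 <= phi x <= L.
  move=> xM; rewrite /phi lerBlDr lerDl sqr_ge0 andbT /L.
  rewrite lerBrDr addrC lerD2r (le_trans (enorm_sqr_le x))// ler_wpM2l//.
  by rewrite lerXn2r ?nnegrE// (le_trans (ltW heps)).
have phi_step x y : Omega x -> enorm y = eps ->
    phi (x + y) + phi (x - y) = 2 * (phi x - eps ^+ 2).
  by move=> _ ye; have := enorm_parallelogram x y; rewrite ye /phi; lra.
exists u; split=> [x|x||].
- exact: (valueIE hj heps oO cg OK stepK C0 gC epsL phiK phi_step uC u_fix).
- exact: (valueIIE hj heps oO cg OK stepK C0 gC epsL phiK phi_step uC u_fix).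
- exact: u_fix.
- exact: (proj2 uC).
Qed.
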